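(* Let $m$, $n$ and $q$ be positive odd integers. Then \[ \sum_{k = 1}^\infty \frac{1}{\prod_{j=0}^{m-1} L_{nk+njq}\,\prod_{j=m+1}^{2m} L_{nk+njq}} = \frac{1}{L_{mnq}}\sum_{k=1}^{q}\frac{1}{\prod_{j=0}^{2m-1}L_{nk+njq}}. \]
   Context: The Lucas numbers are defined by $L_0=2$, $L_1=1$, $L_n=L_{n-1}+L_{n-2}$. Infinite sums are limits of partial sums. *)

(* Defs.v *)
From HB Require Import structures.
From mathcomp Require Import all_boot all_order all_algebra.
From mathcomp Require Import all_classical all_reals all_analysis.

Set Implicit Arguments.
Unset Strict Implicit.
Unset Printing Implicit Defensive.

Fixpoint lucas (n : nat) : nat :=
  match n with
  | 0 => 2
  | 1 => 1
  | (n1.+1 as n2).+1 => lucas n2 + lucas n1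
  end.

(* Main.v *)
(** Put [F k = 1 / \prod_(0 <= j < 2m) L_(nk + njq)]. Then [F k] and [F (k + q)]
    share all but their extreme factors, and the identity
    [L_(a + 2s) - L_a = L_s L_(a + s)] for odd [s], applied to [s = mnq], says
    that [F k - F (k + q)] is [L_(mnq)] times the [k]-th term of the series.
    Hence the series telescopes with step [q], and [F] tends to 0. *)
Require Import Defs.
From HB Require Import structures.
From mathcomp Require Import all_boot all_order all_algebra.
From mathcomp Require Import all_classical all_reals all_analysis.
From mathcomp Require Import ring.

Set Implicit Arguments.
Unset Strict Implicit.
Unset Printing Implicit Defensive.

Import Order.TTheory GRing.Theory Num.Theory.
Import numFieldNormedType.Exports.
Local Open Scope classical_set_scope.
Local Open Scope ring_scope.

Lemma lucasSS k : lucas k.+2 = (lucas k.+1 + lucas k)%N.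
Proof. by []. Qed.

Lemma lucas_gt0 k : (0 < lucas k)%N.
Proof.
suff /andP[] : (0 < lucas k)%N && (0 < lucas k.+1)%N by [].
by elim: k => // k /andP[k0 k1]; rewrite k1 lucasSS addn_gt0 k1.
Qed.

(** A linear lower bound is crude, but it suffices to force the reciprocal products to 0. *)
Lemma leq_lucas k : (k <= lucas k)%N.
Proof.
case: k => // k; elim: k => // k IHk.
by rewrite lucasSS -addn1 leq_add // lucas_gt0.
Qed.

(** With Binet's formula this is multiplication of conjugate powers whose bases have product -1. The
    proof avoids irrationals by a two-step induction on [s]. The offset is generalised because the
    case [s + 2] at [b] calls on [s + 1] at [b + 1] and on [s] at [b + 2]. *)
Lemma lucasM (R : comPzRingType) s a :
  (lucas s)%:R * (lucas (a + s))%:R =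
  (lucas (a + s.*2))%:R + (-1) ^+ s * (lucas a)%:R :> R.
Proof.
suff /(_ a)[] : forall b,
    (lucas s)%:R * (lucas (b + s))%:R =
      (lucas (b + s.*2))%:R + (-1) ^+ s * (lucas b)%:R :> R /\
    (lucas s.+1)%:R * (lucas (b + s.+1))%:R =
      (lucas (b + s.+1.*2))%:R + (-1) ^+ s.+1 * (lucas b)%:R :> R by [].
elim: s => [|s IHs] b.
  rewrite double0 !addn0 addn1 addn2 lucasSS natrD expr0 expr1 /=; split; ring.
split; first by case: (IHs b).
have [_ E1] := IHs b.+1; have [E2 _] := IHs b.+2.
rewrite lucasSS natrD mulrDl.
have -> : (b + s.+2 = b.+1 + s.+1)%N by rewrite addSnnS.
rewrite E1.
have -> : (b.+1 + s.+1 = b.+2 + s)%N by rewrite addnS addSn.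
rewrite E2.
have -> : (b + s.+2.*2 = (b + s.*2).+4)%N by rewrite !doubleS !addnS.
have -> : (b.+1 + s.+1.*2 = (b + s.*2).+3)%N by rewrite !doubleS !addnS !addSn.
have -> : (b.+2 + s.*2 = (b + s.*2).+2)%N by rewrite !addSn.
rewrite (lucasSS (b + s.*2).+2) (lucasSS b) !natrD !exprS; ring.
Qed.

Lemma lucas_doubleB (R : comPzRingType) s a : odd s ->
  (lucas (a + s.*2))%:R - (lucas a)%:R = (lucas s)%:R * (lucas (a + s))%:R :> R.
Proof. by move=> s_odd; rewrite lucasM -signr_odd s_odd mulN1r. Qed.

Lemma sum_shift_telescope (V : zmodType) (F : nat -> V) q N :
  \sum_(1 <= k < N.+1) (F k - F (k + q)%N) =
  \sum_(1 <= k < q.+1) F k - \sum_(1 <= k < q.+1) F (N + k)%N.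
Proof.
elim: N => [|N IHN].
  by rewrite big_geq //; under [X in _ - X]eq_bigr do rewrite add0n; rewrite subrr.
(* Both sides are the sum of [F] from [N + 1] to [N + q + 1], with the last or the first term split
   off. *)
have shift : \sum_(1 <= k < q.+1) F (N + k)%N + F (N.+1 + q)%N =
    F N.+1 + \sum_(1 <= k < q.+1) F (N.+1 + k)%N.
  transitivity (\sum_(1 <= k < q.+2) F (N + k)%N).
    by rewrite [RHS]big_nat_recr //= addSnnS.
  by rewrite big_nat_recl //= addn1; congr (_ + _); under [RHS]eq_bigr do rewrite addSnnS.
rewrite big_nat_recr //= {}IHN -[X in _ = _ - X](addKr (F N.+1)) -shift.
by rewrite !opprD opprK -addrA (addrCA (F N.+1)).
Qed.

(** The remainder after telescoping has a fixed number [q] of terms, each tending to 0. *)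
Lemma cvg_sum_shift (R : numFieldType) (V : normedModType R) (F : nat -> V) q :
  F @ \oo --> (0 : V) ->
  (fun N : nat => \sum_(1 <= k < N.+1) (F k - F (k + q)%N)) @ \oo -->
    \sum_(1 <= k < q.+1) F k.
Proof.
move=> F0; under eq_fun do rewrite sum_shift_telescope.
suff shift0 : (fun N => \sum_(1 <= k < q.+1) F (N + k)%N) @ \oo --> (0 : V).
  by rewrite -[Y in nbhs Y]subr0; apply: cvgB => //; exact: cvg_cst.
suff : (fun N => \sum_(1 <= k < q.+1) F (N + k)%N) @ \oo -->
    \sum_(1 <= k < q.+1) (0 : V) by rewrite big1_eq.
apply: cvg_big => [|k _]; first exact: add_continuous.
by rewrite (cvg_shiftn k F).
Qed.

(** Put everything over the product [T] of all [A j] with [j <= 2 * m]: the three denominators are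
    [T] without [A (2 * m)], without [A 0] and without [A m], respectively. *)
Lemma invr_prod_shiftB (K : fieldType) (A : nat -> K) m c :
    (forall j, A j != 0) -> A (2 * m)%N - A 0%N = c * A m ->
  1 / (\prod_(0 <= j < 2 * m) A j) - 1 / (\prod_(0 <= j < 2 * m) A j.+1) =
  c * (1 / ((\prod_(0 <= j < m) A j) * (\prod_(m.+1 <= j < (2 * m).+1) A j))).
Proof.
move=> A0 Ac.
have prod0 (a b : nat) (B : nat -> nat) : \prod_(a <= j < b) A (B j) != 0.
  by rewrite prodf_seq_neq0; apply/allP => j _; rewrite A0.
have Pl := prod0 0%N (2 * m)%N id; have Pr := prod0 0%N (2 * m)%N S.
have Pa := prod0 0%N m id; have Pb := prod0 m.+1 (2 * m).+1 id.
have El : (\prod_(0 <= j < 2 * m) A j) * A (2 * m)%N = \prod_(0 <= j < (2 * m).+1) A j.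
  by rewrite big_nat_recr.
have Er : A 0%N * (\prod_(0 <= j < 2 * m) A j.+1) = \prod_(0 <= j < (2 * m).+1) A j.
  by rewrite big_nat_recl.
have Em : (\prod_(0 <= j < m) A j) * (A m * (\prod_(m.+1 <= j < (2 * m).+1) A j)) =
    \prod_(0 <= j < (2 * m).+1) A j.
  have m2 : (m < (2 * m).+1)%N by rewrite ltnS leq_pmull.
  by rewrite -big_ltn // -big_cat_nat // ltnW.
have T0 := prod0 0%N (2 * m).+1 id.
set T := \prod_(0 <= j < (2 * m).+1) A j in El Er Em T0.
have -> : 1 / \prod_(0 <= j < 2 * m) A j = A (2 * m)%N / T.
  by apply/eqP; rewrite eqr_div // mul1r mulrC El.
have -> : 1 / \prod_(0 <= j < 2 * m) A j.+1 = A 0%N / T.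
  by apply/eqP; rewrite eqr_div // mul1r Er.
rewrite -mulrBl Ac -mulrA; congr (_ * _).
by apply/eqP; rewrite eqr_div ?mulf_neq0 // mul1r -Em mulrCA.
Qed.

Lemma cvg_invr_prod_lucas (R : realType) (n d p : nat) : (0 < n)%N -> (0 < p)%N ->
  (fun k : nat => 1 / \prod_(0 <= j < p) (lucas (n * k + n * j * d))%:R : R)
    @ \oo --> (0 : R).
Proof.
move=> n0 p0.
apply: (@squeeze_cvgr _ _ _ _ (fun=> 0) (fun k : nat => k%:R^-1)) => //.
- near=> k.
  have k0 : (0 < k)%N by near: k; exact: nbhs_infty_gt.
  rewrite div1r invr_ge0 prodr_ge0 //= lef_pV2 ?posrE ?ltr0n //; last first.
    by apply: prodr_gt0 => j _; rewrite ltr0n lucas_gt0.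
  (* The factor for [j = 0] is already at least [n * k >= k], and the others are at least 1. *)
  rewrite -natr_prod ler_nat big_ltn //.
  apply: leq_trans (leq_pmulr _ _); last by apply: prodn_gt0 => j; exact: lucas_gt0.
  rewrite muln0 mul0n addn0.
  by apply: leq_trans (leq_lucas _); rewrite leq_pmull.
- exact: cvg_cst.
- apply/gtr0_cvgV0; last exact: cvgr_idn.
  near=> k; rewrite ltr0n; near: k; exact: nbhs_infty_gt.
Unshelve. all: by end_near. Qed.

Theorem theorem2p14 (R : realType) (m n q : nat)
    (m_odd : odd m) (n_odd : odd n) (q_odd : odd q) :
  (fun N : nat => \sum_(1 <= k < N.+1)
      1 / ((\prod_(0 <= j < m) (lucas (n * k + n * j * q))%:R) *
           (\prod_(m.+1 <= j < (2 * m).+1) (lucas (n * k + n * j * q))%:R)) : R)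
    @ \oo -->
  1 / (lucas (m * n * q))%:R *
    (\sum_(1 <= k < q.+1)
      1 / \prod_(0 <= j < 2 * m) (lucas (n * k + n * j * q))%:R : R).
Proof.
pose F k : R := 1 / \prod_(0 <= j < 2 * m) (lucas (n * k + n * j * q))%:R.
have lucas_neq0 k : (lucas k)%:R != 0 :> R by rewrite pnatr_eq0 -lt0n lucas_gt0.
have FB k : F k - F (k + q)%N = (lucas (m * n * q))%:R *
    (1 / ((\prod_(0 <= j < m) (lucas (n * k + n * j * q))%:R) *
          (\prod_(m.+1 <= j < (2 * m).+1) (lucas (n * k + n * j * q))%:R))).
  pose A j : R := (lucas (n * k + n * j * q))%:R.
  rewrite -(@invr_prod_shiftB R A) => [||]; rewrite /A //.
    (* Moving [k] by [q] moves [j] by one: [n(k + q) + njq = nk + n(j + 1)q]. *)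
    congr (_ - 1 / _); apply: eq_bigr => j _; congr (lucas _)%:R.
    by rewrite mulnDr mulnS mulnDl -addnA.
  (* Here [a = nk] and [s = nmq], which is odd as a product of odd numbers. *)
  rewrite muln0 mul0n addn0 [(m * n)%N]mulnC -lucas_doubleB ?oddM ?m_odd ?n_odd //.
  by rewrite mul2n -doubleMr -doubleMl.
have -> : (fun N : nat => \sum_(1 <= k < N.+1)
      1 / ((\prod_(0 <= j < m) (lucas (n * k + n * j * q))%:R) *
           (\prod_(m.+1 <= j < (2 * m).+1) (lucas (n * k + n * j * q))%:R)) : R) =
    (fun N => 1 / (lucas (m * n * q))%:R * \sum_(1 <= k < N.+1) (F k - F (k + q)%N)).
  apply/funext => N; rewrite mulr_sumr; apply: eq_bigr => k _.
  by rewrite FB [1 / (lucas (m * n * q))%:R]div1r mulKf.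
apply: cvgM; first exact: cvg_cst.
apply/cvg_sum_shift/cvg_invr_prod_lucas; first exact: odd_gt0.
by rewrite muln_gt0 (odd_gt0 m_odd).
Qed.
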